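(* Let $I\subseteq\mathbb{R}$ be either $(a,b)$, $(a,b]$, $[a,b)$ or $[a,b]$, where $-\infty\le a<b\le\infty$, let $\alpha,\beta: I\to\mathbb{R}$ be continuous, and let $t_0\in(a,b)$. Consider the system $$\bm{x}'=A(t)\bm{x},\qquad A(t)=\begin{pmatrix}\alpha(t)&\beta(t)\\-\beta(t)&\alpha(t)\end{pmatrix},\qquad \bm{x}\in\mathbb{R}^2.\qquad (\ast)$$ Then the following hold. (i) If $\kappa_{31}(t):=\int_t^b e^{-\int_t^s\alpha(\tau)d\tau}ds$ exists for all $t\in I$, $\sup_{t\in I}\kappa_{31}(t)<\infty$, and $\lim_{t\to b-0}\int_{t_0}^t\alpha(s)ds=\infty$, then $(\ast)$ is Ulam stable on $I$, and the best Ulam constant is $K_{31}=\sup_{t\in I}\kappa_{31}(t)$. (ii) If $\kappa_{32}(t):=\int_a^t e^{\int_s^t\alpha(\tau)d\tau}ds$ exists for all $t\in I$, $\sup_{t\in I}\kappa_{32}(t)<\infty$, and $\lim_{t\to a+0}\int_t^{t_0}\alpha(s)ds=-\infty$, then $(\ast)$ is Ulam stable on $I$, and the best Ulam constant is $K_{32}=\sup_{t\in I}\kappa_{32}(t)$.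
   Context: $\|(v_1,v_2)^T\|_2=\sqrt{|v_1|^2+|v_2|^2}$ is the Euclidean norm. The integrals defining the $\kappa$'s are possibly improper, and ''exists'' means that they converge. For continuous $A: I\to\mathbb{R}^{2\times2}$, the equation $\bm{x}'=A(t)\bm{x}$, $\bm{x}\in\mathbb{R}^2$, is called Ulam stable on $I$ if there is a constant $K>0$ such that: for every $\varepsilon>0$ and every continuously differentiable $\bm{\phi}: I\to\mathbb{R}^2$ with $\sup_{t\in I}\|\bm{\phi}'(t)-A(t)\bm{\phi}(t)\|_2\le\varepsilon$, there exists a solution $\bm{x}: I\to\mathbb{R}^2$ of the equation with $\sup_{t\in I}\|\bm{\phi}(t)-\bm{x}(t)\|_2\le K\varepsilon$. Any such $K$ is called an Ulam constant for the equation on $I$. The best Ulam constant is the minimum of all Ulam constants, if this minimum exists. *)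

(* Defs.v *)
From Stdlib Require Export Reals.
From Coquelicot Require Export Coquelicot.
Open Scope R_scope.

(* A subset [I] of the line is encoded by its characteristic predicate, and a
   function on [I] by a total function on [R] of which only the values on [I]
   are ever used. *)

(* [I] is one of (a,b), (a,b], [a,b), [a,b].  As [t] is real, "closed" at an
   infinite endpoint is the same as "open" there. *)
Definition interval_between (a b : Rbar) (I : R -> Prop) : Prop :=
  (forall t : R, I t <-> (Rbar_lt a t /\ Rbar_lt t b)) \/
  (forall t : R, I t <-> (Rbar_lt a t /\ Rbar_le t b)) \/
  (forall t : R, I t <-> (Rbar_le a t /\ Rbar_lt t b)) \/
  (forall t : R, I t <-> (Rbar_le a t /\ Rbar_le t b)).

(* t -> b-0 and t -> a+0, for endpoints that may be infinite. *)
Definition Rbar_at_left (b : Rbar) : (R -> Prop) -> Prop :=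
  within (fun t : R => Rbar_lt t b) (Rbar_locally b).

Definition Rbar_at_right (a : Rbar) : (R -> Prop) -> Prop :=
  within (fun t : R => Rbar_lt a t) (Rbar_locally a).

Definition sup_on (I : R -> Prop) (f : R -> R) : Rbar :=
  Lub_Rbar (fun y : R => exists t : R, I t /\ y = f t).

(* The norm of this product normed module, [prod_norm], is
   sqrt (|v1|^2 + |v2|^2), that is, the Euclidean norm. *)
Definition R2 : NormedModule R_AbsRing :=
  prod_NormedModule R_AbsRing R_NormedModule R_NormedModule.

Definition mulmv (A : @matrix R 2 2) (v : R2) : R2 :=
  (coeff_mat 0 A 0 0 * fst v + coeff_mat 0 A 0 1 * snd v,
   coeff_mat 0 A 1 0 * fst v + coeff_mat 0 A 1 1 * snd v).

(* Derivative relative to [I]: one-sided at an endpoint belonging to [I]. *)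
Definition is_derive_on (I : R -> Prop) (f f' : R -> R2) : Prop :=
  forall t : R, I t ->
    filterdiff f (within I (locally t)) (fun h : R => scal h (f' t)).

Definition is_solution (A : R -> @matrix R 2 2) (I : R -> Prop)
    (x : R -> R2) : Prop :=
  is_derive_on I x (fun t => mulmv (A t) (x t)).

Definition is_Ulam_constant (A : R -> @matrix R 2 2) (I : R -> Prop)
    (K : R) : Prop :=
  0 < K /\
  forall (eps : R) (phi phi' : R -> R2),
    0 < eps ->
    is_derive_on I phi phi' ->
    continuous_on I phi' ->
    Rbar_le (sup_on I (fun t => norm (minus (phi' t) (mulmv (A t) (phi t)))))
            eps ->
    exists x : R -> R2,
      is_solution A I x /\
      Rbar_le (sup_on I (fun t => norm (minus (phi t) (x t)))) (K * eps).

Definition Ulam_stable (A : R -> @matrix R 2 2) (I : R -> Prop) : Prop :=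
  exists K : R, is_Ulam_constant A I K.

Definition is_best_Ulam_constant (A : R -> @matrix R 2 2) (I : R -> Prop)
    (K : R) : Prop :=
  is_Ulam_constant A I K /\
  forall K' : R, is_Ulam_constant A I K' -> K <= K'.

Definition Amat (alpha beta : R -> R) (t : R) : @matrix R 2 2 :=
  [ [ alpha t, beta t ],
    [ - beta t, alpha t ] ].

Definition kappa31_integrand (alpha : R -> R) (t s : R) : R :=
  exp (- RInt alpha t s).

Definition kappa31_exists (alpha : R -> R) (b : Rbar) (t : R) : Prop :=
  ex_RInt_gen (kappa31_integrand alpha t) (at_point t) (Rbar_at_left b).

Definition kappa31 (alpha : R -> R) (b : Rbar) (t : R) : R :=
  RInt_gen (kappa31_integrand alpha t) (at_point t) (Rbar_at_left b).

Definition kappa32_integrand (alpha : R -> R) (t s : R) : R :=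
  exp (RInt alpha s t).

Definition kappa32_exists (alpha : R -> R) (a : Rbar) (t : R) : Prop :=
  ex_RInt_gen (kappa32_integrand alpha t) (Rbar_at_right a) (at_point t).

Definition kappa32 (alpha : R -> R) (a : Rbar) (t : R) : R :=
  RInt_gen (kappa32_integrand alpha t) (Rbar_at_right a) (at_point t).

(* Main.v *)
Require Import Defs.
From Stdlib Require Import Reals Lra Classical.
From Coquelicot Require Import Coquelicot.
Open Scope R_scope.

(** Let [A] and [B] be the antiderivatives of [alpha] and [beta] vanishing at
    [t0], let [X t = turn (A t) (B t)] be the fundamental matrix, and let [G]
    be an antiderivative of [exp (- A)].  Both kappas are [exp (A t) |G t - L|], where [L] is the limit of [G] at the
    relevant end, and in both cases [A] tends to [+oo] there; so one argument,
    along an abstract filter [F], serves for both parts.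

    Upper bound: if [phi] is an [eps]-solution, then [psi = X^-1 phi] satisfies
    [|psi'| <= eps G'], hence [|psi t - psi s| <= eps |G t - G s|].  So [psi]
    has a limit [c] along [F], and the solution [X c] is within
    [eps exp (A t) |G t - L|] of [phi].

    Lower bound: [phi = X (G - L, 0)] is an exact 1-solution.  A solution [X c]
    at bounded distance from it must have [c = 0], because [exp A] tends to
    [+oo] while [G - L] tends to [0]; its distance to [phi] is then
    [exp (A t) |G t - L|]. *)

(** * Derivatives and integrals relative to a convex set *)

(** Order convexity treats the four shapes of [I], bounded or not, uniformly. *)
Definition convex_set (I : R -> Prop) : Prop :=
  forall x y z : R, I x -> I z -> x <= y <= z -> I y.

(** The scalar counterpart of [is_derive_on], one-sided at an endpoint in [I]; as a [filterdiff] it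
    inherits the composition rules for filters. *)
Definition is_derive_within (I : R -> Prop) (f : R -> R) (t l : R) : Prop :=
  filterdiff f (within I (locally t)) (fun h : R => scal h l).

Lemma within_locally_proper (I : R -> Prop) (t : R) :
  I t -> ProperFilter (within I (locally t)).
Proof.
  intros It. split.
  - intros P HP. exists t. exact (locally_singleton _ _ HP It).
  - apply within_filter, locally_filter.
Qed.

Lemma within_locally_lim (I : R -> Prop) (t : R) :
  is_filter_lim (within I (locally t)) t.
Proof. intros P HP. apply filter_le_within, HP. Qed.

(** [filterdiff] quantifies over all limits of its filter. Membership of [t] in [I] makes the filter
    proper, so its limit is unique. *)
Lemma within_locally_lim_unique (I : R -> Prop) (t x : R) :
  I t -> is_filter_lim (within I (locally t)) x -> x = t.
Proof.
  intros It Hx.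
  apply (@is_filter_lim_unique R_AbsRing R_NormedModule
    (within I (locally t)) (Proper_StrongProper _ (within_locally_proper I t It))).
  exact Hx. apply within_locally_lim.
Qed.

Lemma is_derive_within_ext (I : R -> Prop) (f g : R -> R) (t l l' : R) :
  I t -> (forall s, I s -> f s = g s) -> l = l' ->
  is_derive_within I f t l -> is_derive_within I g t l'.
Proof.
  intros It E <- H. unfold is_derive_within in *.
  apply (filterdiff_ext_loc f).
  - exists (mkposreal 1 Rlt_0_1). intros y _ Iy. now apply E.
  - intros x Hx. apply within_locally_lim_unique in Hx as ->; auto.
  - exact H.
Qed.

Lemma is_derive_is_derive_within (I : R -> Prop) (f : R -> R) (t l : R) :
  I t -> is_derive f t l -> is_derive_within I f t l.
Proof.
  intros It H. assert (PF := within_locally_proper I t It).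
  apply (filterdiff_locally f t). apply within_locally_lim. exact H.
Qed.

(** The way back to ordinary derivatives, as the classical mean value theorem requires at interior
    points. *)
Lemma is_derive_within_interior (I : R -> Prop) (f : R -> R) (t l : R) :
  locally t I -> is_derive_within I f t l -> is_derive f t l.
Proof.
  intros Ht [Hl H]. split. exact Hl.
  intros x Hx eps. apply (@is_filter_lim_locally_unique R_AbsRing R_NormedModule) in Hx.
  rewrite <- Hx.
  generalize (filter_and _ _ Ht (H t (within_locally_lim I t) eps)).
  apply filter_imp. intros y [Iy Hy]. now apply Hy.
Qed.

Lemma is_derive_within_filterlim (I : R -> Prop) (f : R -> R) (t l : R) :
  is_derive_within I f t l -> filterlim f (within I (locally t)) (locally (f t)).
Proof.
  intros H.
  apply (@filterdiff_continuous_aux R_AbsRing R_NormedModule R_NormedModule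
    (within I (locally t)) _).
  - now exists (fun h : R => scal h l).
  - apply within_locally_lim.
Qed.

Lemma is_derive_within_const (I : R -> Prop) (c t : R) :
  is_derive_within I (fun _ => c) t 0.
Proof.
  apply filterdiff_ext_lin with (fun _ : R => zero).
  - apply (filterdiff_const (V := R_NormedModule)).
  - intros y. unfold scal; simpl; unfold mult; simpl. now rewrite Rmult_0_r.
Qed.

Lemma is_derive_within_plus (I : R -> Prop) (f g : R -> R) (t lf lg : R) :
  is_derive_within I f t lf -> is_derive_within I g t lg ->
  is_derive_within I (fun s => f s + g s) t (lf + lg).
Proof.
  intros Hf Hg.
  eapply filterdiff_ext_lin.
  - apply (filterdiff_plus_fct f g _ _ Hf Hg).
  - intros y. unfold scal, plus; simpl; unfold mult; simpl. ring.
Qed.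

Lemma is_derive_within_mult (I : R -> Prop) (f g : R -> R) (t lf lg : R) :
  I t -> is_derive_within I f t lf -> is_derive_within I g t lg ->
  is_derive_within I (fun s => f s * g s) t (lf * g t + f t * lg).
Proof.
  intros It Hf Hg. assert (PF := within_locally_proper I t It).
  eapply filterdiff_ext_lin.
  - apply (filterdiff_comp_2 f g Rmult _ _
      (fun u v => u * g t + f t * v) Hf Hg).
    apply (filterdiff_mult (f t, g t)).
    + intros P [e He].
      generalize (filter_and _ _
        (proj1 (filterlim_locally _ _) (is_derive_within_filterlim I f t lf Hf) e)
        (proj1 (filterlim_locally _ _) (is_derive_within_filterlim I g t lg Hg) e)).
      unfold filtermap. apply filter_imp. intros x [H1 H2]. apply He. now split.
    + exact Rmult_comm.
  - intros y. unfold scal; simpl; unfold mult; simpl.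
    match goal with |- @eq _ ?x ?y => change (@eq R x y) end. ring.
Qed.

Lemma is_derive_within_comp (I : R -> Prop) (f g : R -> R) (t lf lg : R) :
  I t -> is_derive_within I f t lf -> is_derive g (f t) lg ->
  is_derive_within I (fun s => g (f s)) t (lg * lf).
Proof.
  intros It Hf Hg. assert (PF := within_locally_proper I t It).
  eapply filterdiff_ext_lin.
  - apply (filterdiff_comp (U := R_NormedModule) (V := R_NormedModule)
      (W := R_NormedModule) f g _ (fun h : R => scal h lg) Hf).
    apply (filterdiff_locally (U := R_NormedModule)
      (F := filtermap f (within I (locally t))) g (f t)); [| exact Hg].
    exact (is_derive_within_filterlim I f t lf Hf).
  - intros y. unfold scal; simpl; unfold mult; simpl.
    match goal with |- @eq _ ?x ?y => change (@eq R x y) end. ring.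
Qed.

Lemma is_derive_within_scal (I : R -> Prop) (c : R) (f : R -> R) (t l : R) :
  I t -> is_derive_within I f t l -> is_derive_within I (fun s => c * f s) t (c * l).
Proof.
  intros It H.
  apply (is_derive_within_ext I (fun s => c * f s) _ t (0 * f t + c * l)); auto.
  - ring.
  - now apply (is_derive_within_mult I (fun _ => c)), H; [| apply is_derive_within_const].
Qed.

Lemma is_derive_within_opp (I : R -> Prop) (f : R -> R) (t l : R) :
  I t -> is_derive_within I f t l -> is_derive_within I (fun s => - f s) t (- l).
Proof.
  intros It H.
  apply (is_derive_within_ext I (fun s => -1 * f s) _ t (-1 * l)); auto.
  - intros; ring.
  - ring.
  - now apply is_derive_within_scal.
Qed.

(* Composing with [clamp c d] turns a function that is continuous only relative
   to [I] into one that is continuous on the whole line and unchanged on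
   [c, d], so that the library's theorems on total functions apply. *)
Definition clamp (c d x : R) : R := Rmax c (Rmin d x).

Lemma clamp_bounds (c d x : R) : c <= d -> c <= clamp c d x <= d.
Proof.
  intros H. unfold clamp, Rmax, Rmin.
  destruct (Rle_dec d x), (Rle_dec c _); lra.
Qed.

Lemma clamp_id (c d x : R) : c <= x <= d -> clamp c d x = x.
Proof.
  intros H. unfold clamp. rewrite Rmin_right, Rmax_right; lra.
Qed.

Lemma clamp_lipschitz (c d x y : R) :
  Rabs (clamp c d x - clamp c d y) <= Rabs (x - y).
Proof.
  unfold clamp, Rmin.
  destruct (Rle_dec d x), (Rle_dec d y); unfold Rmax;
    repeat match goal with |- context [Rle_dec c ?b] => destruct (Rle_dec c b) end;
    unfold Rabs; repeat match goal with
      |- context [Rcase_abs ?b] => destruct (Rcase_abs b) end; lra.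
Qed.

Lemma continuous_clamp (I : R -> Prop) (f : R -> R) (c d : R) :
  convex_set I -> continuous_on I f -> I c -> I d -> c <= d ->
  forall x, continuous (fun y => f (clamp c d y)) x.
Proof.
  intros HI Hf Ic Id cd x.
  assert (HC : forall y, I (clamp c d y)).
  { intros y. apply (HI c _ d); auto. now apply clamp_bounds. }
  apply (filterlim_comp _ _ _ (clamp c d) f _
    (within I (locally (clamp c d x)))); [| now apply Hf].
  intros P [e He]. exists e. intros y Hy. apply He; auto.
  unfold ball in *; simpl in *; unfold AbsRing_ball, abs, minus, plus, opp in *; simpl in *.
  eapply Rle_lt_trans. apply clamp_lipschitz. exact Hy.
Qed.

Lemma convex_set_interior (I : R -> Prop) (c d x : R) :
  convex_set I -> I c -> I d -> c < x < d -> locally x I.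
Proof.
  intros HI Ic Id H.
  apply (filter_imp (fun y => c < y /\ y < d)).
  - intros y Hy. apply (HI c y d); auto. lra.
  - apply filter_and; [apply open_gt | apply open_lt]; lra.
Qed.

(** * Mean value theorems relative to [I] *)

Lemma mean_value_within (I : R -> Prop) (h h' : R -> R) (s t : R) :
  convex_set I -> (forall r, I r -> is_derive_within I h r (h' r)) ->
  I s -> I t -> s <= t ->
  exists c, I c /\ h t - h s = h' c * (t - s).
Proof.
  intros HI Hh Is It st.
  destruct (MVT_gen (fun y => h (clamp s t y)) s t h') as (c & Hc & E).
  - rewrite Rmin_left, Rmax_right by auto. intros x Hx.
    apply is_derive_ext_loc with h.
    + apply (filter_imp (fun y => s < y /\ y < t)).
      * intros y Hy. rewrite clamp_id; lra.
      * apply filter_and; [apply open_gt | apply open_lt]; lra.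
    + apply (is_derive_within_interior I).
      * now apply (convex_set_interior I s t).
      * apply Hh, (HI s x t); auto. lra.
  - intros x _. apply continuity_pt_filterlim.
    apply (continuous_clamp I); auto.
    intros r Ir. apply (is_derive_within_filterlim I h r (h' r)), Hh, Ir.
  - rewrite Rmin_left, Rmax_right in Hc by auto.
    rewrite !clamp_id in E by lra.
    exists c. split; auto. now apply (HI s c t).
Qed.

(** With [d] the increment of [(p, q)], the function [d . (p, q) - |d| g] has nonpositive
    derivative. Its increment [|d|^2 - |d| (g t - g s)] is therefore nonpositive, and [|d|] can be
    divided out unless it vanishes. *)
Lemma vector_mean_value (I : R -> Prop) (p q g p' q' g' : R -> R) (s t : R) :
  convex_set I ->
  (forall r, I r -> is_derive_within I p r (p' r)) ->
  (forall r, I r -> is_derive_within I q r (q' r)) ->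
  (forall r, I r -> is_derive_within I g r (g' r)) ->
  (forall r, I r -> Cmod (p' r, q' r) <= g' r) ->
  I s -> I t ->
  Cmod (p t - p s, q t - q s) <= Rabs (g t - g s).
Proof.
  intros HI Hp Hq Hg Hb.
  assert (W : forall s t, I s -> I t -> s <= t ->
    Cmod (p t - p s, q t - q s) <= Rabs (g t - g s)).
  { clear s t. intros s t Is It st.
    set (d1 := p t - p s). set (d2 := q t - q s). set (n := Cmod (d1, d2)).
    (* Scalar mean value theorem for the increment's direction, then Cauchy-Schwarz. *)
    destruct (mean_value_within I
      (fun r => (d1 * p r + d2 * q r) + (- n) * g r)
      (fun r => d1 * p' r + d2 * q' r + - n * g' r) s t)
      as (c & Ic & E); auto.
    { intros r Ir.
      apply (is_derive_within_plus I (fun r => d1 * p r + d2 * q r)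
        (fun r => - n * g r)).
      - apply (is_derive_within_plus I (fun r => d1 * p r) (fun r => d2 * q r));
          apply is_derive_within_scal; auto.
      - apply is_derive_within_scal; auto. }
    assert (n2 : n * n = d1 * d1 + d2 * d2).
    { unfold n, Cmod; simpl. rewrite sqrt_sqrt; nra. }
    assert (n0 : 0 <= n) by apply Cmod_ge_0.
    assert (CS : d1 * p' c + d2 * q' c <= n * Cmod (p' c, q' c)).
    { set (m := Cmod (p' c, q' c)).
      assert (m2 : m * m = p' c * p' c + q' c * q' c).
      { unfold m, Cmod; simpl. rewrite sqrt_sqrt; nra. }
      assert (m0 : 0 <= m) by apply Cmod_ge_0.
      apply Rsqr_incr_0_var; [|nra]. unfold Rsqr.
      replace (n * m * (n * m)) with ((n * n) * (m * m)) by ring.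
      (* Lagrange's identity: the square added here is the gap in Cauchy-Schwarz. *)
      rewrite n2, m2. pose proof (Rle_0_sqr (d1 * q' c - d2 * p' c)). unfold Rsqr in *. nra. }
    assert (Hle : n * n <= n * (g t - g s)).
    { specialize (Hb c Ic). fold d1 d2 in E.
      assert (E' : n * n - n * (g t - g s)
        = (d1 * p' c + d2 * q' c - n * g' c) * (t - s)).
      { rewrite n2. unfold d1, d2 in *. lra. }
      assert (d1 * p' c + d2 * q' c - n * g' c <= 0) by nra. nra. }
    destruct (Req_dec n 0) as [->|nn]; [apply Rabs_pos|].
    eapply Rle_trans; [|apply Rle_abs]. nra. }
  intros Is It. destruct (Rle_dec s t) as [st|ts].
  - now apply W.
  - rewrite Rabs_minus_sym. rewrite <- Cmod_opp.
    replace (Copp (p t - p s, q t - q s)) with (p s - p t, q s - q t)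
      by (unfold Copp; simpl; f_equal; ring).
    apply W; auto; lra.
Qed.

(** * Integrals of functions continuous relative to [I] *)

Lemma ex_RInt_on (I : R -> Prop) (f : R -> R) (s t : R) :
  convex_set I -> continuous_on I f -> I s -> I t -> ex_RInt f s t.
Proof.
  intros HI Hf.
  assert (W : forall s t, I s -> I t -> s <= t -> ex_RInt f s t).
  { clear s t. intros s t Is It st.
    apply ex_RInt_ext with (fun y => f (clamp s t y)).
    - rewrite Rmin_left, Rmax_right by auto. intros x Hx. rewrite clamp_id; lra.
    - apply (ex_RInt_continuous (V := R_CompleteNormedModule)).
      intros z _. now apply (continuous_clamp I). }
  intros Is It. destruct (Rle_dec s t) as [st|ts]; auto.
  apply ex_RInt_swap. apply W; auto; lra.
Qed.

(** With its mirror image below, this encloses [t0] and all points of [I] near [t] in a segment with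
    ends in [I], on which clamping is possible. If nothing in [I] lies beyond [t], then [t] is its
    maximum and bounds from above. *)
Lemma within_upper_bound (I : R -> Prop) (t0 t : R) :
  I t0 -> I t ->
  exists d, I d /\ t0 <= d /\ t <= d /\ within I (locally t) (fun s => s <= d).
Proof.
  intros I0 It. destruct (classic (exists d, I d /\ t < d)) as [(d & Id & td)|N].
  - exists (Rmax t0 d). repeat split.
    + now apply Rmax_case.
    + apply Rmax_l.
    + pose proof (Rmax_r t0 d); lra.
    + apply filter_le_within. apply (filter_imp (fun s => s < d)).
      * intros s Hs. pose proof (Rmax_r t0 d); lra.
      * now apply open_lt.
  - exists t. assert (B : forall s, I s -> s <= t).
    { intros s Is. apply Rnot_lt_le. intros H. apply N. now exists s. }
    repeat split; auto; try lra.
    exists (mkposreal 1 Rlt_0_1). intros; auto.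
Qed.

Lemma within_lower_bound (I : R -> Prop) (t0 t : R) :
  I t0 -> I t ->
  exists c, I c /\ c <= t0 /\ c <= t /\ within I (locally t) (fun s => c <= s).
Proof.
  intros I0 It. destruct (classic (exists d, I d /\ d < t)) as [(d & Id & td)|N].
  - exists (Rmin t0 d). repeat split.
    + now apply Rmin_case.
    + apply Rmin_l.
    + pose proof (Rmin_r t0 d); lra.
    + apply filter_le_within. apply (filter_imp (fun s => d < s)).
      * intros s Hs. pose proof (Rmin_r t0 d); lra.
      * now apply open_gt.
  - exists t. assert (B : forall s, I s -> t <= s).
    { intros s Is. apply Rnot_lt_le. intros H. apply N. now exists s. }
    repeat split; auto; try lra.
    exists (mkposreal 1 Rlt_0_1). intros; auto.
Qed.

(** The fundamental theorem of calculus for the clamped integrand, whose integral from [t0] agrees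
    with the given one at all points of [I] near [t], even if [t] is an endpoint. *)
Lemma is_derive_within_RInt (I : R -> Prop) (f : R -> R) (t0 t : R) :
  convex_set I -> continuous_on I f -> I t0 -> I t ->
  is_derive_within I (fun s => RInt f t0 s) t (f t).
Proof.
  intros HI Hf I0 It.
  destruct (within_upper_bound I t0 t I0 It) as (d & Id & d0 & dt & Wd).
  destruct (within_lower_bound I t0 t I0 It) as (c & Ic & c0 & ct & Wc).
  assert (E : forall s, c <= s <= d ->
    RInt (fun y => f (clamp c d y)) t0 s = RInt f t0 s).
  { intros s Hs. apply RInt_ext. intros x Hx. rewrite clamp_id; auto.
    revert Hx. unfold Rmin, Rmax. destruct Rle_dec; lra. }
  apply (filterdiff_ext_loc (fun s => RInt (fun y => f (clamp c d y)) t0 s)).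
  - generalize (filter_and (F := within I (locally t)) _ _ Wc Wd).
    apply filter_imp. intros s Hs. now apply E.
  - intros x Hx. apply within_locally_lim_unique in Hx as ->; auto.
  - assert (CC : forall x, continuous (fun y => f (clamp c d y)) x).
    { apply (continuous_clamp I); auto. lra. }
    apply is_derive_is_derive_within; auto.
    replace (f t) with ((fun y => f (clamp c d y)) t) by (rewrite clamp_id; auto; lra).
    apply (is_derive_RInt (fun y => f (clamp c d y)) _ t0 t).
    + exists (mkposreal 1 Rlt_0_1). intros y _.
      apply (RInt_correct (V := R_CompleteNormedModule)).
      apply (ex_RInt_continuous (V := R_CompleteNormedModule)). auto.
    + apply CC.
Qed.

(** * The fundamental matrix of the system *)

Lemma norm_R2 (v : R2) : norm v = Cmod v.
Proof.
  unfold norm; simpl. unfold prod_norm, Cmod, norm; simpl; unfold abs; simpl.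
  f_equal. now rewrite !Rmult_1_r, <- !Rabs_mult, !Rabs_pos_eq by apply Rle_0_sqr.
Qed.

Lemma is_derive_on_components (I : R -> Prop) (f f' : R -> R2) :
  is_derive_on I f f' <->
  forall t, I t -> is_derive_within I (fun s => fst (f s)) t (fst (f' t)) /\
                   is_derive_within I (fun s => snd (f s)) t (snd (f' t)).
Proof.
  split; intros H t It; specialize (H t It); assert (PF := within_locally_proper I t It).
  - split.
    + apply (filterdiff_comp (F := within I (locally t)) (V := R2) f
        (fun v : R2 => fst v) _ (fun v : R2 => fst v) H).
      apply filterdiff_linear, (is_linear_fst (U := R_NormedModule) (V := R_NormedModule)).
    + apply (filterdiff_comp (F := within I (locally t)) (V := R2) f
        (fun v : R2 => snd v) _ (fun v : R2 => snd v) H).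
      apply filterdiff_linear, (is_linear_snd (U := R_NormedModule) (V := R_NormedModule)).
  - destruct H as [H1 H2].
    apply (filterdiff_ext (F := within I (locally t)) (V := R2)
      (fun s => (fst (f s), snd (f s)))).
    { intros y. now destruct (f y). }
    apply (filterdiff_comp_2 (F := within I (locally t)) (U := R_NormedModule)
      (V := R_NormedModule) (W := R2) _ _ (fun u v => (u, v)) _ _ (fun u v => (u, v)) H1 H2).
    apply (filterdiff_linear (V := R2)).
    apply (is_linear_prod (U := R_NormedModule) (V := R_NormedModule)).
    + apply is_linear_fst.
    + apply is_linear_snd.
Qed.

Lemma is_derive_on_ext (I : R -> Prop) (f f' g' : R -> R2) :
  (forall t, I t -> f' t = g' t) -> is_derive_on I f f' -> is_derive_on I f g'.
Proof. intros E H t It. rewrite <- E by exact It. now apply H. Qed.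

Lemma mean_value_R2 (I : R -> Prop) (v v' : R -> R2) (g g' : R -> R) (s t : R) :
  convex_set I -> is_derive_on I v v' ->
  (forall r, I r -> is_derive_within I g r (g' r)) ->
  (forall r, I r -> norm (v' r) <= g' r) ->
  I s -> I t ->
  norm (minus (v t) (v s)) <= Rabs (g t - g s).
Proof.
  intros HI Hv Hg Hb Is It. rewrite is_derive_on_components in Hv.
  rewrite norm_R2.
  apply (vector_mean_value I (fun r => fst (v r)) (fun r => snd (v r)) g
    (fun r => fst (v' r)) (fun r => snd (v' r)) g'); auto.
  - intros r Ir. now apply Hv.
  - intros r Ir. now apply Hv.
  - intros r Ir. rewrite <- surjective_pairing, <- norm_R2. now apply Hb.
Qed.

Lemma mulmv_Amat (alpha beta : R -> R) (t : R) (v : R2) :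
  mulmv (Amat alpha beta t) v =
  (alpha t * fst v + beta t * snd v, - beta t * fst v + alpha t * snd v).
Proof. reflexivity. Qed.

(* [turn x y] is the exponential of the matrix [[x, y], [-y, x]]. *)
Definition turn (x y : R) (v : R2) : R2 :=
  (exp x * (cos y * fst v + sin y * snd v),
   exp x * (cos y * snd v - sin y * fst v)).

Lemma turn_opp (x y : R) (v : R2) : turn x y (turn (- x) (- y) v) = v.
Proof.
  assert (E : exp x * exp (- x) = 1) by (rewrite <- exp_plus, Rplus_opp_r; apply exp_0).
  assert (T := sin2_cos2 y). unfold Rsqr in T.
  destruct v as [p q]. unfold turn; simpl. rewrite cos_neg, sin_neg. f_equal.
  - transitivity (exp x * exp (- x) * (sin y * sin y + cos y * cos y) * p); [ring|].
    rewrite E, T. ring.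
  - transitivity (exp x * exp (- x) * (sin y * sin y + cos y * cos y) * q); [ring|].
    rewrite E, T. ring.
Qed.

Lemma turn_minus (x y : R) (u v : R2) :
  turn x y (minus u v) = minus (turn x y u) (turn x y v).
Proof.
  unfold turn, minus, plus, opp; simpl. unfold prod_plus, prod_opp, plus, opp; simpl.
  f_equal; ring.
Qed.

(** The rotation part is an isometry, so the scaling factor alone survives. This exact equality lets
    the upper and lower bounds meet. *)
Lemma norm_turn (x y : R) (v : R2) : norm (turn x y v) = exp x * norm v.
Proof.
  rewrite !norm_R2. destruct v as [p q]. unfold Cmod, turn; simpl.
  assert (T := sin2_cos2 y). unfold Rsqr in T.
  symmetry. rewrite <- (sqrt_pow2 (exp x) (Rlt_le _ _ (exp_pos x))) at 1.
  rewrite <- sqrt_mult_alt by apply pow2_ge_0. symmetry. f_equal.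
  transitivity (exp x ^ 2 * ((sin y * sin y + cos y * cos y) *
    (p * (p * 1) + q * (q * 1)))); [ring|].
  rewrite T. ring.
Qed.

(** Both matrices are combinations of the identity and one fixed quarter turn, hence they
    commute. *)
Lemma mulmv_turn (alpha beta : R -> R) (t x y : R) (v : R2) :
  mulmv (Amat alpha beta t) (turn x y v) = turn x y (mulmv (Amat alpha beta t) v).
Proof.
  rewrite !mulmv_Amat. unfold turn; simpl. f_equal; ring.
Qed.

Lemma is_derive_within_turn (I : R -> Prop) (A B p q : R -> R) (t a b p' q' : R) :
  I t ->
  is_derive_within I A t a -> is_derive_within I B t b ->
  is_derive_within I p t p' -> is_derive_within I q t q' ->
  is_derive_within I (fun s => exp (A s) * (cos (B s) * p s + sin (B s) * q s)) t
    (exp (A t) * (cos (B t) * (a * p t + b * q t + p')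
                  + sin (B t) * (- b * p t + a * q t + q'))).
Proof.
  intros It HA HB Hp Hq.
  eapply is_derive_within_ext with (2 := fun s _ => eq_refl); [exact It| |].
  2: { apply (is_derive_within_mult I (fun s => exp (A s))
         (fun s => cos (B s) * p s + sin (B s) * q s)); [exact It| |].
       - apply (is_derive_within_comp I A exp); eauto. apply is_derive_exp.
       - apply (is_derive_within_plus I (fun s => cos (B s) * p s) (fun s => sin (B s) * q s)).
         + apply (is_derive_within_mult I (fun s => cos (B s))); eauto.
           apply (is_derive_within_comp I B cos); eauto. apply is_derive_cos.
         + apply (is_derive_within_mult I (fun s => sin (B s))); eauto.
           apply (is_derive_within_comp I B sin); eauto. apply is_derive_sin. }
  simpl. ring.
Qed.

(** The product rule for [X v], with [X] moved to the left by commutation. Constant [v] gives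
    solutions; reversed signs of [A] and [B] give the derivative of [X^-1 phi]. *)
Lemma is_derive_on_turn (I : R -> Prop) (A B alpha beta : R -> R) (v v' : R -> R2) :
  (forall t, I t -> is_derive_within I A t (alpha t)) ->
  (forall t, I t -> is_derive_within I B t (beta t)) ->
  is_derive_on I v v' ->
  is_derive_on I (fun t => turn (A t) (B t) (v t))
    (fun t => turn (A t) (B t) (plus (mulmv (Amat alpha beta t) (v t)) (v' t))).
Proof.
  intros HA HB Hv. rewrite is_derive_on_components in Hv |- *. intros t It.
  destruct (Hv t It) as [Hp Hq]. split.
  - eapply is_derive_within_ext with (2 := fun s _ => eq_refl); [exact It| |].
    2: exact (is_derive_within_turn I A B _ _ t _ _ _ _ It (HA t It) (HB t It) Hp Hq).
    rewrite mulmv_Amat; unfold turn, plus; simpl; unfold prod_plus, plus; simpl. ring.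
  (* The second component is the first one with the angle negated and the coordinates exchanged. *)
  - eapply is_derive_within_ext with
      (f := fun s => exp (A s) * (cos (-1 * B s) * snd (v s) + sin (-1 * B s) * fst (v s)));
      [exact It| | |].
    3: exact (is_derive_within_turn I A _ _ _ t _ _ _ _ It (HA t It)
         (is_derive_within_scal I (-1) B t _ It (HB t It)) Hq Hp).
    + intros s _. simpl. replace (-1 * B s) with (- B s) by ring.
      rewrite cos_neg, sin_neg. ring.
    + rewrite mulmv_Amat. cbv beta. replace (-1 * B t) with (- B t) by ring.
      rewrite cos_neg, sin_neg. unfold turn, plus; simpl; unfold prod_plus, plus; simpl. ring.
Qed.

(** * Suprema over [I] *)

Lemma sup_on_le (I : R -> Prop) (f : R -> R) (M : R) :
  Rbar_le (sup_on I f) M <-> forall t, I t -> f t <= M.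
Proof.
  destruct (Lub_Rbar_correct (fun y => exists t, I t /\ y = f t)) as [H1 H2].
  fold (sup_on I f) in H1, H2. split.
  - intros H t It. apply (Rbar_le_trans (f t) (sup_on I f) M); auto.
    apply H1. now exists t.
  - intros H. apply H2. intros y (t & It & ->). now apply H.
Qed.

(** A point of [I] rules out [m_infty], so passing to [real] loses nothing. *)
Lemma sup_on_finite (I : R -> Prop) (f : R -> R) (t : R) :
  I t -> Rbar_lt (sup_on I f) p_infty -> sup_on I f = Finite (real (sup_on I f)).
Proof.
  intros It H.
  assert (L : Rbar_le (f t) (sup_on I f)).
  { apply (proj1 (Lub_Rbar_correct (fun y => exists t, I t /\ y = f t))). now exists t. }
  destruct (sup_on I f); simpl in *; easy.
Qed.

(** * The optimal bound, for an abstract end of the interval *)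

Lemma norm_R2_le (v : R2) : norm v <= Rabs (fst v) + Rabs (snd v).
Proof.
  rewrite norm_R2. destruct v as [p q]. unfold Cmod; simpl fst; simpl snd.
  assert (H1 := Rabs_pos p). assert (H2 := Rabs_pos q).
  rewrite <- (sqrt_pow2 (Rabs p + Rabs q)) by lra.
  apply sqrt_le_1_alt. rewrite <- (pow2_abs p), <- (pow2_abs q). nra.
Qed.

Lemma Rabs_fst_le_norm (v : R2) : Rabs (fst v) <= norm v.
Proof.
  rewrite norm_R2. eapply Rle_trans; [apply Rmax_l|apply Rmax_Cmod].
Qed.

Lemma Rabs_snd_le_norm (v : R2) : Rabs (snd v) <= norm v.
Proof.
  rewrite norm_R2. eapply Rle_trans; [apply Rmax_r|apply Rmax_Cmod].
Qed.

Lemma norm_minus_triangle (u v w : R2) :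
  norm (minus u w) <= norm (minus u v) + norm (minus v w).
Proof.
  replace (minus u w) with (plus (minus u v) (minus v w)); [apply norm_triangle|].
  symmetry. apply (minus_trans (G := R2)).
Qed.

Lemma norm_le_minus_plus (u v : R2) : norm u <= norm (minus u v) + norm v.
Proof.
  replace u with (plus (minus u v) v) at 1; [apply norm_triangle|].
  unfold minus. rewrite <- plus_assoc, plus_opp_l. apply plus_zero_r.
Qed.

Lemma minus_plus_l_R2 (u v : R2) : minus (plus u v) u = v.
Proof.
  destruct u, v. unfold minus, plus, opp; simpl.
  unfold prod_plus, prod_opp, plus, opp; simpl. f_equal; ring.
Qed.

Lemma filterlim_Rabs_lt {T : Type} (F : (T -> Prop) -> Prop) {FF : Filter F}
    (f : T -> R) (l d : R) :
  filterlim f F (locally l) -> 0 < d -> F (fun s => Rabs (f s - l) < d).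
Proof.
  intros H d0. exact (proj1 (filterlim_locally f l) H (mkposreal d d0)).
Qed.

(** The oscillation of [h] is at most [k] times that of the convergent [G], so the Cauchy criterion
    applies. *)
Lemma Cauchy_dominated (F : (R -> Prop) -> Prop) (I : R -> Prop) (h G : R -> R) (k L : R) :
  ProperFilter F -> F I -> filterlim G F (locally L) -> 0 < k ->
  (forall s t, I s -> I t -> Rabs (h t - h s) <= k * Rabs (G t - G s)) ->
  exists c, filterlim h F (locally c).
Proof.
  intros PF FI HG k0 H. apply (filterlim_locally_cauchy (U := R_CompleteSpace)).
  (* Two values of [G] within [d] of [L] differ by less than [2 d], and [k] times this is [e]. *)
  intros e. set (d := e / (2 * k)).
  assert (d0 : 0 < d) by (apply Rdiv_lt_0_compat; [apply cond_pos | lra]).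
  exists (fun s => I s /\ Rabs (G s - L) < d). split.
  - apply filter_and; auto. apply (filterlim_Rabs_lt F); [exact HG|exact d0].
  - intros u v [Iu Hu] [Iv Hv].
    change (Rabs (h v - h u) < e).
    apply Rle_lt_trans with (1 := H u v Iu Iv).
    assert (B : Rabs (G v - G u) < 2 * d).
    { replace (G v - G u) with ((G v - L) - (G u - L)) by ring.
      eapply Rle_lt_trans; [apply Rabs_triang|]. rewrite Rabs_Ropp. lra. }
    replace (pos e) with (k * (2 * d)) by (unfold d; field; lra).
    now apply Rmult_lt_compat_l.
Qed.

(** The limit [c] is taken componentwise; the estimate arises by letting [s] run along [F] in the
    hypothesis. *)
Lemma exists_limit_dominated (F : (R -> Prop) -> Prop) (I : R -> Prop)
    (v : R -> R2) (G : R -> R) (k L : R) :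
  ProperFilter F -> F I -> filterlim G F (locally L) -> 0 < k ->
  (forall s t, I s -> I t -> norm (minus (v t) (v s)) <= k * Rabs (G t - G s)) ->
  exists c : R2, forall t, I t -> norm (minus (v t) c) <= k * Rabs (G t - L).
Proof.
  intros PF FI HG k0 H.
  destruct (Cauchy_dominated F I (fun s => fst (v s)) G k L) as [c1 H1]; auto.
  { intros s t Is It. eapply Rle_trans; [|now apply H].
    apply (Rabs_fst_le_norm (minus (v t) (v s))). }
  destruct (Cauchy_dominated F I (fun s => snd (v s)) G k L) as [c2 H2]; auto.
  { intros s t Is It. eapply Rle_trans; [|now apply H].
    apply (Rabs_snd_le_norm (minus (v t) (v s))). }
  exists (c1, c2). intros t It. apply le_epsilon. intros e e0.
  (* The error is [k d] from [G s] and [d] from each coordinate of [v s], in all [(k + 2) d]. *)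
  set (d := e / (k + 2)).
  assert (d0 : 0 < d) by (apply Rdiv_lt_0_compat; lra).
  destruct (filter_ex (F := F) _ (filter_and _ _ FI
    (filter_and _ _ (filterlim_Rabs_lt F _ _ d HG d0)
      (filter_and _ _ (filterlim_Rabs_lt F _ _ d H1 d0)
        (filterlim_Rabs_lt F _ _ d H2 d0))))) as (s & Is & Gs & s1 & s2).
  eapply Rle_trans; [apply (norm_minus_triangle _ (v s))|].
  assert (N := norm_R2_le (minus (v s) (c1, c2))).
  change (norm (minus (v s) (c1, c2)) <= Rabs (fst (v s) - c1) + Rabs (snd (v s) - c2)) in N.
  assert (M := H s t Is It).
  assert (B : Rabs (G t - G s) <= Rabs (G t - L) + d).
  { replace (G t - G s) with ((G t - L) - (G s - L)) by ring.
    eapply Rle_trans; [apply Rabs_triang|]. rewrite Rabs_Ropp. lra. }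
  assert (E : e = k * d + 2 * d) by (unfold d; field; lra).
  assert (k * Rabs (G t - G s) <= k * (Rabs (G t - L) + d)) by (apply Rmult_le_compat_l; lra).
  lra.
Qed.

Lemma Ulam_constant_of_bound (I : R -> Prop) (A B G alpha beta : R -> R)
    (F : (R -> Prop) -> Prop) (L K : R) :
  convex_set I ->
  (forall t, I t -> is_derive_within I A t (alpha t)) ->
  (forall t, I t -> is_derive_within I B t (beta t)) ->
  (forall t, I t -> is_derive_within I G t (exp (- A t))) ->
  ProperFilter F -> F I -> filterlim G F (locally L) -> 0 < K ->
  (forall t, I t -> exp (A t) * Rabs (G t - L) <= K) ->
  is_Ulam_constant (Amat alpha beta) I K.
Proof.
  intros HI HA HB HG PF FI GL K0 HK. split; [exact K0|].
  intros eps phi phi' e0 Hphi _ Hf.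
  rewrite sup_on_le in Hf.
  set (psi := fun t => turn (- A t) (- B t) (phi t)).
  assert (Hpsi := is_derive_on_turn I (fun t => - A t) (fun t => - B t)
    (fun t => - alpha t) (fun t => - beta t) phi phi').
  destruct (exists_limit_dominated F I psi G eps L) as [c Hc]; auto.
  { intros s t Is It.
    rewrite <- (Rabs_pos_eq eps) by lra.
    rewrite <- Rabs_mult, Rmult_minus_distr_l.
    eapply (mean_value_R2 I psi _ (fun r => eps * G r) (fun r => eps * exp (- A r))); auto.
    - apply Hpsi; auto.
      + intros r Ir. apply is_derive_within_opp; auto.
      + intros r Ir. apply is_derive_within_opp; auto.
    - intros r Ir. now apply is_derive_within_scal; auto.
    - intros r Ir. cbv beta; rewrite norm_turn, Rmult_comm.
      apply Rmult_le_compat_r; [apply Rlt_le, exp_pos|].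
      (* With the signs of [alpha] and [beta] reversed, the derivative of [psi] is [X^-1] applied to
         the defect of [phi]. *)
      replace (plus _ _) with (minus (phi' r) (mulmv (Amat alpha beta r) (phi r))).
      + now apply Hf.
      + rewrite !mulmv_Amat. unfold minus, plus, opp; simpl.
        unfold prod_plus, prod_opp, plus, opp; simpl. f_equal; ring. }
  exists (fun t => turn (A t) (B t) c). split.
  - apply is_derive_on_ext with (2 := is_derive_on_turn I A B alpha beta
      (fun _ => c) (fun _ => zero) HA HB
      (fun t It => proj2 (is_derive_on_components _ (fun _ => c) (fun _ => zero))
         (fun t It => conj (is_derive_within_const I (fst c) t)
                           (is_derive_within_const I (snd c) t)) t It)).
    intros t It. rewrite plus_zero_r. now rewrite mulmv_turn.
  - rewrite sup_on_le. intros t It.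
    (* Writing [phi] as [X psi] turns the error into [X (psi - c)]. *)
    rewrite <- (turn_opp (A t) (B t) (phi t)), <- turn_minus, norm_turn.
    apply Rle_trans with (exp (A t) * (eps * Rabs (G t - L))).
    + apply Rmult_le_compat_l; [apply Rlt_le, exp_pos|]. now apply Hc.
    + specialize (HK t It). nra.
Qed.

(** * Continuity relative to [I], for the extremal approximate solution *)

Lemma continuous_on_plus (I : R -> Prop) (f g : R -> R) :
  continuous_on I f -> continuous_on I g -> continuous_on I (fun t => f t + g t).
Proof.
  intros Hf Hg t It.
  apply (filterlim_comp_2 f g Rplus (Hf t It) (Hg t It)), (filterlim_plus (f t) (g t)).
Qed.

Lemma continuous_on_mult (I : R -> Prop) (f g : R -> R) :
  continuous_on I f -> continuous_on I g -> continuous_on I (fun t => f t * g t).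
Proof.
  intros Hf Hg t It.
  apply (filterlim_comp_2 f g Rmult (Hf t It) (Hg t It)), (filterlim_mult (f t) (g t)).
Qed.

Lemma continuous_on_comp (I : R -> Prop) (f g : R -> R) :
  continuous_on I f -> (forall x, continuous g x) -> continuous_on I (fun t => g (f t)).
Proof.
  intros Hf Hg t It. exact (filterlim_comp _ _ _ f g _ _ _ (Hf t It) (Hg (f t))).
Qed.

Lemma continuous_on_const (I : R -> Prop) (c : R) : continuous_on I (fun _ : R => c).
Proof. apply continuous_on_forall. intros x _. apply continuous_const. Qed.

Lemma continuous_on_R2 (I : R -> Prop) (f g : R -> R) :
  continuous_on I f -> continuous_on I g ->
  continuous_on (U := R2) I (fun t => (f t, g t)).
Proof.
  intros Hf Hg t It. apply filterlim_locally. intros e.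
  generalize (filter_and (F := within I (locally t)) _ _
    (proj1 (filterlim_locally f (f t)) (Hf t It) e)
    (proj1 (filterlim_locally g (g t)) (Hg t It) e)).
  apply filter_imp. intros s Hs. exact Hs.
Qed.

(** Serves to show that the derivative of the extremal function is continuous, as an admissible
    [phi] requires. *)
Lemma continuous_on_turn (I : R -> Prop) (A B p q : R -> R) :
  continuous_on I A -> continuous_on I B -> continuous_on I p -> continuous_on I q ->
  continuous_on (U := R2) I (fun t => turn (A t) (B t) (p t, q t)).
Proof.
  intros HA HB Hp Hq.
  assert (HE : continuous_on I (fun t => exp (A t))).
  { apply continuous_on_comp; auto. intros x. apply continuous_exp. }
  assert (HC : continuous_on I (fun t => cos (B t))).
  { apply continuous_on_comp; auto. intros x. apply continuous_cos. }
  assert (HS : continuous_on I (fun t => sin (B t))).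
  { apply continuous_on_comp; auto. intros x. apply continuous_sin. }
  apply continuous_on_R2.
  - repeat (apply continuous_on_mult || apply continuous_on_plus); auto.
  - apply (continuous_on_ext I (fun t =>
      exp (A t) * (cos (B t) * q t + (-1) * (sin (B t) * p t)))).
    { intros t _. simpl. ring. }
    repeat (apply continuous_on_mult || apply continuous_on_plus); auto using continuous_on_const.
Qed.

Lemma bound_of_Ulam_constant (I : R -> Prop) (A B G alpha beta : R -> R)
    (F : (R -> Prop) -> Prop) (L K : R) :
  convex_set I -> continuous_on I alpha -> continuous_on I beta ->
  (forall t, I t -> is_derive_within I A t (alpha t)) ->
  (forall t, I t -> is_derive_within I B t (beta t)) ->
  (forall t, I t -> is_derive_within I G t (exp (- A t))) ->
  ProperFilter F -> F I -> filterlim G F (locally L) ->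
  filterlim A F (Rbar_locally p_infty) ->
  is_Ulam_constant (Amat alpha beta) I K ->
  forall t, I t -> exp (A t) * Rabs (G t - L) <= K.
Proof.
  intros HI Ca Cb HA HB HG PF FI GL Ainf [K0 HK].
  assert (CA : continuous_on I A).
  { intros r Ir. exact (is_derive_within_filterlim I A r _ (HA r Ir)). }
  assert (CB : continuous_on I B).
  { intros r Ir. exact (is_derive_within_filterlim I B r _ (HB r Ir)). }
  assert (CG : continuous_on I G).
  { intros r Ir. exact (is_derive_within_filterlim I G r _ (HG r Ir)). }
  (* The extremal choice of [X^-1 phi]: it moves along a fixed direction at speed exactly
     [exp (- A)], so the estimates of the upper bound become equalities. *)
  set (w := fun t : R => (G t + - L, 0) : R2).
  assert (Wn : forall t, norm (w t) = Rabs (G t + - L)).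
  { intros t. rewrite norm_R2. exact (Cmod_R _). }
  set (w' := fun t : R => (exp (- A t), 0) : R2).
  assert (Hw : is_derive_on I w w').
  { rewrite is_derive_on_components. intros r Ir. split.
    - apply (is_derive_within_ext I (fun s => G s + - L) _ r (exp (- A r) + 0)); auto.
      + simpl. ring.
      + apply (is_derive_within_plus I G (fun _ => - L)); auto. apply is_derive_within_const.
    - exact (is_derive_within_const I 0 r). }
  assert (Hphi := is_derive_on_turn I A B alpha beta w w' HA HB Hw).
  destruct (HK 1 _ _ Rlt_0_1 Hphi) as (x & Hx & Hb).
  - apply (continuous_on_ext I (fun t => turn (A t) (B t)
      (alpha t * (G t + - L) + exp (- A t), (-1) * (beta t * (G t + - L))))).
    { intros t _. f_equal. rewrite mulmv_Amat. unfold plus; simpl.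
      unfold prod_plus, plus; simpl. f_equal; ring. }
    apply continuous_on_turn; auto;
      repeat (apply continuous_on_mult || apply continuous_on_plus);
      auto using continuous_on_const.
    apply (continuous_on_ext I (fun t => exp ((-1) * A t))).
    { intros t _. f_equal. ring. }
    apply (continuous_on_comp I (fun t => -1 * A t)).
    + apply continuous_on_mult; auto using continuous_on_const.
    + apply continuous_exp.
  - rewrite sup_on_le. intros t It.
    (* The defect is [X w'], of norm [exp (A t) * exp (- A t) = 1]. *)
    rewrite mulmv_turn, <- turn_minus, minus_plus_l_R2, norm_turn, norm_R2. unfold w'.
    change (exp (A t) * Cmod (RtoC (exp (- A t))) <= 1).
    rewrite Cmod_R, Rabs_pos_eq by apply Rlt_le, exp_pos.
    rewrite <- exp_plus, Rplus_opp_r, exp_0. lra.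
  - rewrite sup_on_le in Hb. rewrite Rmult_1_r in Hb.
    set (c := fun t => turn (- A t) (- B t) (x t)).
    assert (Dx : forall t, I t -> norm (minus (w t) (c t)) <= K * exp (- A t)).
    { intros t It. specialize (Hb t It).
      rewrite <- (turn_opp (A t) (B t) (x t)), <- turn_minus, norm_turn in Hb.
      apply Rmult_le_reg_l with (exp (A t)); [apply exp_pos|].
      replace (exp (A t) * (K * exp (- A t))) with (K * (exp (A t) * exp (- A t))) by ring.
      rewrite <- exp_plus, Rplus_opp_r, exp_0, Rmult_1_r. exact Hb. }
    (* Since [x] is a solution, [X^-1 x] has derivative zero; the mean value inequality with [g = 0]
       makes it constant on [I]. *)
    assert (Cc : forall s t, I s -> I t -> norm (minus (c t) (c s)) <= 0).
    { intros s t Is It. replace 0 with (Rabs (0 - 0)) by (rewrite Rminus_0_r; apply Rabs_R0).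
      apply (mean_value_R2 I c (fun _ => zero) (fun _ => 0) (fun _ => 0)); auto.
      - apply is_derive_on_ext with (2 := is_derive_on_turn I (fun t => - A t) (fun t => - B t)
          (fun t => - alpha t) (fun t => - beta t) x _
          (fun r Ir => is_derive_within_opp I A r _ Ir (HA r Ir))
          (fun r Ir => is_derive_within_opp I B r _ Ir (HB r Ir)) Hx).
        intros r _. rewrite !mulmv_Amat. unfold turn, plus, zero; simpl.
        unfold prod_plus, prod_zero, plus, zero; simpl. f_equal; ring.
      - intros r _. apply is_derive_within_const.
      - intros r _. rewrite norm_zero. lra. }
    (* For [s] far along [F], [|c t| <= |c t - c s| + |c s - w s| + |w s|]. The first term vanishes,
       the second is at most [K exp (- A s)], the third is [|G s - L|]; the last two are each below
       [e / 2]. *)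
    assert (c0 : forall t, I t -> norm (c t) <= 0).
    { intros t It. apply le_epsilon. intros e e0.
      assert (d0 : 0 < e / 2) by lra.
      assert (FE : F (fun s => K * exp (- A s) < e / 2)).
      (* The threshold solves [K exp (- y) = e / 2] for [y]. *)
      { apply (filter_imp (fun s => ln (2 * K / e) < A s)).
        - intros s Hs.
          assert (q0 : 0 < 2 * K / e) by (apply Rdiv_lt_0_compat; lra).
          apply exp_increasing in Hs. rewrite exp_ln in Hs by exact q0.
          apply Rmult_lt_reg_r with (exp (A s)); [apply exp_pos|].
          rewrite Rmult_assoc, <- exp_plus, Rplus_opp_l, exp_0, Rmult_1_r.
          replace K with (e / 2 * (2 * K / e)) at 1 by (field; lra).
          now apply Rmult_lt_compat_l.
        - apply (Ainf (fun y => ln (2 * K / e) < y)). now exists (ln (2 * K / e)). }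
      destruct (filter_ex (F := F) _ (filter_and _ _ FI (filter_and _ _ FE
        (filterlim_Rabs_lt F _ _ (e / 2) GL d0)))) as (s & Is & Es & Gs).
      assert (T1 := norm_le_minus_plus (c t) (c s)).
      assert (T2 := norm_le_minus_plus (c s) (w s)).
      assert (N : forall u v : R2, norm (minus u v) = norm (minus v u)).
      { intros u v. rewrite <- (norm_opp (minus u v)). now rewrite opp_minus. }
      rewrite (N (c s) (w s)) in T2.
      specialize (Cc s t Is It). specialize (Dx s Is). rewrite Wn in T2.
      unfold Rminus in Gs. lra. }
    intros t It.
    assert (T := norm_le_minus_plus (w t) (c t)).
    rewrite Wn in T. specialize (Dx t It). specialize (c0 t It).
    replace K with (exp (A t) * (K * exp (- A t))).
    + apply Rmult_le_compat_l; [apply Rlt_le, exp_pos|]. unfold Rminus. lra.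
    + rewrite Rmult_comm, Rmult_assoc, <- exp_plus, Rplus_opp_l, exp_0. ring.
Qed.

(** The pointwise bound characterises Ulam constants, so the least one is the supremum of [kap]. Two
    distinct points of [I] ensure that it is positive. *)
Lemma sup_on_best_Ulam_constant (I : R -> Prop) (A B G alpha beta kap : R -> R)
    (F : (R -> Prop) -> Prop) (L s t : R) :
  convex_set I -> continuous_on I alpha -> continuous_on I beta ->
  (forall t, I t -> is_derive_within I A t (alpha t)) ->
  (forall t, I t -> is_derive_within I B t (beta t)) ->
  (forall t, I t -> is_derive_within I G t (exp (- A t))) ->
  ProperFilter F -> F I -> filterlim G F (locally L) ->
  filterlim A F (Rbar_locally p_infty) ->
  (forall t, I t -> kap t = exp (A t) * Rabs (G t - L)) ->
  I s -> I t -> s < t -> Rbar_lt (sup_on I kap) p_infty ->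
  Ulam_stable (Amat alpha beta) I /\
  is_best_Ulam_constant (Amat alpha beta) I (real (sup_on I kap)).
Proof.
  intros HI Ca Cb HA HB HG PF FI GL Ainf Hk Is It st Hfin.
  assert (E := sup_on_finite I kap s Is Hfin). set (K := real (sup_on I kap)) in *.
  assert (HK : forall r, I r -> kap r <= K).
  { apply sup_on_le. rewrite E. apply Rle_refl. }
  (* [G] is strictly increasing, so it differs from [L] at [s] or at [t], and there [kap] is
     positive. *)
  assert (K0 : 0 < K).
  { assert (Gst : G t <> G s).
    { destruct (mean_value_within I G (fun r => exp (- A r)) s t) as (c & _ & M); auto.
      lra. assert (P := exp_pos (- A c)). nra. }
    assert (pos : forall r, I r -> G r <> L -> 0 < K).
    { intros r Ir N. apply Rlt_le_trans with (2 := HK r Ir). rewrite Hk by exact Ir.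
      apply Rmult_lt_0_compat; [apply exp_pos|]. apply Rabs_pos_lt. lra. }
    destruct (Req_dec (G s) L) as [e|n]; [apply (pos t It) | apply (pos s Is)]; congruence. }
  assert (UK : is_Ulam_constant (Amat alpha beta) I K).
  { apply (Ulam_constant_of_bound I A B G alpha beta F L K); auto.
    intros r Ir. rewrite <- Hk by exact Ir. now apply HK. }
  repeat split; [now exists K | exact K0 | apply UK |].
  intros K' HK'. change (Rbar_le K K'). rewrite <- E. apply sup_on_le.
  intros r Ir. rewrite Hk by exact Ir.
  now apply (bound_of_Ulam_constant I A B G alpha beta F L K').
Qed.

(** * The improper integrals and the two ends of the interval *)

(** Fixing one end collapses the limit over a product filter to a limit in the other end.
    Integrability along [F] guarantees that [RInt] is a genuine integral there. *)
Lemma is_RInt_gen_at_point_iff (F : (R -> Prop) -> Prop) (f : R -> R) (t l : R) :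
  Filter F -> F (fun s => ex_RInt f t s) ->
  is_RInt_gen f (at_point t) F l <-> filterlim (fun s => RInt f t s) F (locally l).
Proof.
  intros FF Fex. split.
  - intros H P HP. destruct (H P HP) as [Q S HQ HS HQS]. unfold filtermap.
    apply (filter_imp S); auto. intros s Ss.
    destruct (HQS t s HQ Ss) as (z & Hz & Pz). simpl in Hz.
    now rewrite (is_RInt_unique f t s z Hz).
  - intros H P HP. apply (Filter_prod (at_point t) F _ (eq t)
      (fun s => P (RInt f t s) /\ ex_RInt f t s)).
    + reflexivity.
    + apply filter_and; auto. exact (H P HP).
    + intros x s <- [Hs Es]. exists (RInt f t s). split; auto.
      now apply (RInt_correct (V := R_CompleteNormedModule)).
Qed.

Lemma RInt_from_base (I : R -> Prop) (f : R -> R) (t0 s t : R) :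
  convex_set I -> continuous_on I f -> I t0 -> I s -> I t ->
  RInt f s t = RInt f t0 t - RInt f t0 s.
Proof.
  intros HI Hf I0 Is It.
  rewrite <- (RInt_Chasles f t0 s t) by (apply (ex_RInt_on I); auto).
  symmetry. apply Rplus_minus_l.
Qed.

Lemma convex_set_Rmin_Rmax (I : R -> Prop) (s t x : R) :
  convex_set I -> I s -> I t -> Rmin s t <= x <= Rmax s t -> I x.
Proof.
  intros HI Is It. apply HI; [now apply Rmin_case | now apply Rmax_case].
Qed.

Lemma continuous_exp_opp (x : R) : continuous (fun y => exp (- y)) x.
Proof. apply (ex_derive_continuous (fun y => exp (- y))). now auto_derive. Qed.

(** The integrand at [t] factors as [exp (A t) * exp (- A s)], so the partial integral is
    [exp (A t) * (G s - G t)]. Convergence for the base point [t0] yields the limit of [G], and with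
    it the value for every [t]. No end is prescribed for [F], so this serves both parts. *)
Lemma kappa31_filterlim (I : R -> Prop) (alpha : R -> R) (F : (R -> Prop) -> Prop)
    (t0 l : R) :
  let A : R -> R := fun t => RInt alpha t0 t in
  let G : R -> R := fun t => RInt (fun s => exp (- A s)) t0 t in
  convex_set I -> continuous_on I alpha -> I t0 -> Filter F -> F I ->
  is_RInt_gen (kappa31_integrand alpha t0) (at_point t0) F l ->
  filterlim G F (locally l) /\
  forall t, I t ->
    is_RInt_gen (kappa31_integrand alpha t) (at_point t) F (exp (A t) * (l - G t)).
Proof.
  intros A G HI Ha I0 FF FI H0.
  assert (CE : continuous_on I (fun s => exp (- A s))).
  { apply (continuous_on_comp I A (fun x => exp (- x))).
    - intros r Ir. apply (is_derive_within_filterlim I A r (alpha r)).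
      now apply is_derive_within_RInt.
    - exact continuous_exp_opp. }
  assert (EI : forall t s x, I t -> I s -> Rmin t s < x < Rmax t s ->
    exp (A t) * exp (- A x) = kappa31_integrand alpha t x).
  { intros t s x It Is Hx. unfold kappa31_integrand.
    rewrite (RInt_from_base I alpha t0 t x); auto.
    - rewrite <- exp_plus. f_equal. unfold A. ring.
    - apply (convex_set_Rmin_Rmax I t s); auto; lra. }
  assert (Ex : forall t s, I t -> I s -> ex_RInt (kappa31_integrand alpha t) t s).
  { intros t s It Is. apply ex_RInt_ext with (fun x => exp (A t) * exp (- A x)).
    - intros x Hx. now apply (EI t s).
    - apply (ex_RInt_scal (V := R_NormedModule) (fun x => exp (- A x))).
      now apply (ex_RInt_on I). }
  assert (Val : forall t s, I t -> I s ->
    RInt (kappa31_integrand alpha t) t s = exp (A t) * (G s - G t)).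
  { intros t s It Is. rewrite <- (RInt_ext (fun x => exp (A t) * exp (- A x))).
    - rewrite (RInt_scal (V := R_CompleteNormedModule) (fun x => exp (- A x)))
        by now apply (ex_RInt_on I).
      rewrite (RInt_from_base I (fun x => exp (- A x)) t0 t s); auto.
    - intros x Hx. now apply (EI t s). }
  assert (FEx : forall t, I t -> F (fun s => ex_RInt (kappa31_integrand alpha t) t s)).
  { intros t It. apply (filter_imp I); auto. }
  (* [A] and [G] vanish at [t0], so the partial integral from [t0] is [G] itself. *)
  assert (GL : filterlim G F (locally l)).
  { rewrite is_RInt_gen_at_point_iff in H0 by auto.
    apply (filterlim_ext_loc (fun s => RInt (kappa31_integrand alpha t0) t0 s)); [|exact H0].
    apply (filter_imp I); [|exact FI]. intros s Is. rewrite Val by auto.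
    unfold G at 2, A. rewrite !RInt_point. unfold zero; simpl. rewrite exp_0. ring. }
  split; [exact GL|]. intros t It. rewrite is_RInt_gen_at_point_iff by auto.
  apply (filterlim_ext_loc (fun s => exp (A t) * (G s + - G t))).
  - apply (filter_imp I); auto. intros s Is. now rewrite Val.
  - apply (filterlim_comp_2 (fun _ => exp (A t)) (fun s => G s + - G t) Rmult
      (filterlim_const (exp (A t))) (H := locally (l - G t))).
    + apply (filterlim_comp_2 G (fun _ => - G t) Rplus GL (filterlim_const (- G t))).
      apply (filterlim_plus l (- G t)).
    + apply (filterlim_mult (exp (A t)) (l - G t)).
Qed.

(** Reversing the inner integral identifies the integrands; reversing the outer one changes the sign
    of the value. *)
Lemma kappa32_kappa31 (I : R -> Prop) (alpha : R -> R) (F : (R -> Prop) -> Prop) (t l : R) :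
  convex_set I -> continuous_on I alpha -> Filter F -> F I -> I t ->
  is_RInt_gen (kappa32_integrand alpha t) F (at_point t) l <->
  is_RInt_gen (kappa31_integrand alpha t) (at_point t) F (- l).
Proof.
  intros HI Ha FF FI It.
  assert (E : forall x s y, I s -> x = t -> Rmin s x < y < Rmax s x ->
    kappa32_integrand alpha t y = kappa31_integrand alpha t y).
  { intros x s y Is -> Hy. unfold kappa32_integrand, kappa31_integrand. f_equal.
    rewrite <- (opp_RInt_swap alpha t y); auto.
    apply (ex_RInt_on I); auto. apply (convex_set_Rmin_Rmax I s t); auto; lra. }
  split; intros H.
  - apply (is_RInt_gen_swap (V := R_NormedModule)).
    apply is_RInt_gen_ext with (2 := H).
    apply (Filter_prod F (at_point t) _ I (eq t)); auto; [reflexivity|].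
    intros s x Is <- y Hy. now apply (E t s).
  - rewrite <- (Ropp_involutive l). apply (is_RInt_gen_swap (V := R_NormedModule)).
    apply is_RInt_gen_ext with (2 := H).
    apply (Filter_prod (at_point t) F _ (eq t) I); auto; [reflexivity|].
    intros x s <- Is y Hy. symmetry. apply (E t s); auto.
    simpl in Hy. now rewrite Rmin_comm, Rmax_comm.
Qed.

(** * The interval and the filters at its two ends *)

Lemma interval_between_open (a b : Rbar) (I : R -> Prop) (t : R) :
  interval_between a b I -> Rbar_lt a t -> Rbar_lt t b -> I t.
Proof.
  intros hI at_ tb.
  assert (at' := Rbar_lt_le _ _ at_). assert (tb' := Rbar_lt_le _ _ tb).
  destruct hI as [H|[H|[H|H]]]; apply H; auto.
Qed.

Lemma interval_between_closed (a b : Rbar) (I : R -> Prop) (t : R) :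
  interval_between a b I -> I t -> Rbar_le a t /\ Rbar_le t b.
Proof.
  intros hI It.
  destruct hI as [H|[H|[H|H]]]; apply H in It as [H1 H2]; auto using Rbar_lt_le.
Qed.

Lemma interval_between_convex (a b : Rbar) (I : R -> Prop) :
  interval_between a b I -> convex_set I.
Proof.
  intros hI x y z Ix Iz Hy.
  destruct hI as [H|[H|[H|H]]]; apply H in Ix; apply H in Iz; apply H;
    destruct a, b; simpl in *; lra.
Qed.

(** A real [t] below [b] excludes [b = m_infty], where the filter would contain the empty set. *)
Lemma Rbar_at_left_proper (b : Rbar) (t : R) : Rbar_lt t b -> ProperFilter (Rbar_at_left b).
Proof.
  intros tb. split; [|apply within_filter, Rbar_locally_filter].
  destruct b as [b| |]; [| |easy].
  - exact (fun P => @filter_ex _ _ (at_left_proper_filter b) P).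
  - intros P [M HM]. exists (M + 1). apply HM; simpl; auto. lra.
Qed.

Lemma Rbar_at_right_proper (a : Rbar) (t : R) : Rbar_lt a t -> ProperFilter (Rbar_at_right a).
Proof.
  intros ta. split; [|apply within_filter, Rbar_locally_filter].
  destruct a as [a| |]; [|easy|].
  - exact (fun P => @filter_ex _ _ (at_right_proper_filter a) P).
  - intros P [M HM]. exists (M - 1). apply HM; simpl; auto. lra.
Qed.

Lemma Rbar_at_left_gt (b : Rbar) (t : R) :
  Rbar_lt t b -> Rbar_at_left b (fun s => t < s /\ Rbar_lt s b).
Proof.
  intros tb. unfold Rbar_at_left, within.
  apply (filter_imp (fun s : R => Rbar_lt t s)); [now intros s Hs|].
  now apply open_Rbar_gt'.
Qed.

Lemma Rbar_at_right_lt (a : Rbar) (t : R) :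
  Rbar_lt a t -> Rbar_at_right a (fun s => Rbar_lt a s /\ s < t).
Proof.
  intros ta. unfold Rbar_at_right, within.
  apply (filter_imp (fun s : R => Rbar_lt s t)); [now intros s Hs|].
  now apply open_Rbar_lt'.
Qed.

(** Continuity bounds [A] by [A t + 1] on [I] near [t], which contradicts divergence along a filter
    converging to [t]. Hence the end in question does not belong to [I]. *)
Lemma unbounded_not_in (I : R -> Prop) (A : R -> R) (F : (R -> Prop) -> Prop) (t : R) :
  ProperFilter F -> F I -> filterlim A F (Rbar_locally p_infty) ->
  continuous_on I A -> I t -> ~ filter_le F (locally t).
Proof.
  intros PF FI Ainf CA It HF.
  assert (C := proj1 (filterlim_locally A (A t)) (CA t It) (mkposreal 1 Rlt_0_1)).
  apply HF in C.
  assert (D : F (fun s => A t + 1 < A s)).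
  { apply (Ainf (fun y => A t + 1 < y)). now exists (A t + 1). }
  destruct (filter_ex (F := F) _ (filter_and _ _ FI (filter_and _ _ C D))) as (s & Is & Cs & Ds).
  specialize (Cs Is). change (Rabs (A s - A t) < 1) in Cs.
  apply Rabs_lt_between in Cs. lra.
Qed.

(** Fixes the sign of [G t - L], which removes the absolute value from the formula for the
    kappas. *)
Lemma exp_antiderivative_increasing (I : R -> Prop) (A G : R -> R) (s t : R) :
  convex_set I -> (forall t, I t -> is_derive_within I G t (exp (- A t))) ->
  I s -> I t -> s <= t -> G s <= G t.
Proof.
  intros HI HG Is It st.
  destruct (mean_value_within I G (fun r => exp (- A r)) s t) as (c & _ & M); auto.
  assert (P := exp_pos (- A c)). nra.
Qed.

Theorem theorem5p3 (a b : Rbar) (I : R -> Prop) (alpha beta : R -> R) (t0 : R)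
    (hab : Rbar_lt a b)
    (hI : interval_between a b I)
    (halpha : continuous_on I alpha)
    (hbeta : continuous_on I beta)
    (hat0 : Rbar_lt a t0)
    (ht0b : Rbar_lt t0 b) :
  ((forall t : R, I t -> kappa31_exists alpha b t) ->
   Rbar_lt (sup_on I (kappa31 alpha b)) p_infty ->
   filterlim (fun t : R => RInt alpha t0 t)
     (Rbar_at_left b) (Rbar_locally p_infty) ->
   Ulam_stable (Amat alpha beta) I /\
   is_best_Ulam_constant (Amat alpha beta) I
     (real (sup_on I (kappa31 alpha b))))
  /\
  ((forall t : R, I t -> kappa32_exists alpha a t) ->
   Rbar_lt (sup_on I (kappa32 alpha a)) p_infty ->
   filterlim (fun t : R => RInt alpha t t0)
     (Rbar_at_right a) (Rbar_locally m_infty) ->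
   Ulam_stable (Amat alpha beta) I /\
   is_best_Ulam_constant (Amat alpha beta) I
     (real (sup_on I (kappa32 alpha a)))).
Proof.
  assert (HI := interval_between_convex a b I hI).
  assert (I0 := interval_between_open a b I t0 hI hat0 ht0b).
  set (A := (fun t => RInt alpha t0 t) : R -> R).
  set (B := (fun t => RInt beta t0 t) : R -> R).
  set (G := (fun t => RInt (fun s => exp (- A s)) t0 t) : R -> R).
  assert (HA : forall t, I t -> is_derive_within I A t (alpha t)).
  { intros t It. now apply is_derive_within_RInt. }
  assert (HB : forall t, I t -> is_derive_within I B t (beta t)).
  { intros t It. now apply is_derive_within_RInt. }
  assert (CA : continuous_on I A).
  { intros r Ir. exact (is_derive_within_filterlim I A r _ (HA r Ir)). }
  assert (CE : continuous_on I (fun s => exp (- A s))).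
  { apply (continuous_on_comp I A (fun x => exp (- x))); auto.
    exact continuous_exp_opp. }
  assert (HG : forall t, I t -> is_derive_within I G t (exp (- A t))).
  { intros t It. now apply (is_derive_within_RInt I (fun s => exp (- A s))). }
  split; intros Hex Hfin Hlim.
  - set (F := Rbar_at_left b) in *.
    assert (PF : ProperFilter F) by now apply (Rbar_at_left_proper b t0).
    assert (FI : F I).
    { apply (filter_imp (fun s => t0 < s /\ Rbar_lt s b)); [|now apply Rbar_at_left_gt].
      intros s [t0s sb]. apply (interval_between_open a b); auto.
      now apply (Rbar_lt_trans a t0 s). }
    destruct (Hex t0 I0) as [L HL].
    destruct (kappa31_filterlim I alpha F t0 L HI halpha I0 _ FI HL) as [GL Hk].
    (* Were [b] a point of [I], [A] would be bounded near it; so every [t] in [I] leaves room for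
       some [s] between [t] and [b]. *)
    assert (tb : forall t, I t -> Rbar_lt t b).
    { intros t It. destruct (interval_between_closed a b I t hI It) as [_ H].
      apply Rbar_le_lt_or_eq_dec in H as [H|H]; auto. exfalso.
      apply (unbounded_not_in I A F t PF FI Hlim CA It). unfold F. rewrite <- H.
      apply filter_le_within. }
    destruct (filter_ex (F := F) _ (filter_and _ _ FI (Rbar_at_left_gt b t0 ht0b)))
      as (t1 & I1 & t01 & _).
    apply (sup_on_best_Ulam_constant I A B G alpha beta _ F L t0 t1); auto.
    intros t It. unfold kappa31. fold F.
    rewrite (is_RInt_gen_unique _ _ (Hk t It)). fold A G.
    f_equal. rewrite Rabs_minus_sym, Rabs_pos_eq; auto.
    apply Rge_le, Rge_minus, Rle_ge.
    (* [G t <= G s] for [s] between [t] and [b]; in the limit [G t <= L]. *)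
    apply (filterlim_le (F := F) (fun _ => G t) G (G t) L); auto.
    + generalize (filter_and _ _ FI (Rbar_at_left_gt b t (tb t It))).
      apply filter_imp. intros s (Is & ts & _).
      apply (exp_antiderivative_increasing I A G t s); auto. lra.
    + apply filterlim_const.
  - set (F := Rbar_at_right a) in *.
    assert (PF : ProperFilter F) by now apply (Rbar_at_right_proper a t0).
    assert (FI : F I).
    { apply (filter_imp (fun s : R => Rbar_lt a s /\ s < t0)); [|now apply Rbar_at_right_lt].
      intros s [as_ st0]. apply (interval_between_open a b); auto.
      now apply (Rbar_lt_trans s t0 b). }
    destruct (Hex t0 I0) as [L' HL].
    (* [L'] is the integral from [a] to [t0], whereas [G] integrates from [t0] towards [a]; its
       limit is therefore [- L']. *)
    apply (kappa32_kappa31 I) in HL; auto; [|apply PF]. set (L := - L') in *.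
    destruct (kappa31_filterlim I alpha F t0 L HI halpha I0 _ FI HL) as [GL Hk].
    (* The hypothesis concerns the integral from [t] to [t0], which is [- A t]; so [A] tends to
       [+oo] at [a] as well. *)
    assert (Ainf : filterlim A F (Rbar_locally p_infty)).
    { apply (filterlim_ext_loc (fun t => - RInt alpha t t0)).
      - apply (filter_imp I); auto. intros s Is.
        apply (opp_RInt_swap alpha s t0). now apply (ex_RInt_on I).
      - apply (filterlim_comp _ _ _ _ Ropp _ _ _ Hlim). apply (filterlim_Rbar_opp m_infty). }
    assert (ta : forall t, I t -> Rbar_lt a t).
    { intros t It. destruct (interval_between_closed a b I t hI It) as [H _].
      apply Rbar_le_lt_or_eq_dec in H as [H|H]; auto. exfalso.
      apply (unbounded_not_in I A F t PF FI Ainf CA It). unfold F. rewrite H.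
      apply filter_le_within. }
    destruct (filter_ex (F := F) _ (filter_and _ _ FI (Rbar_at_right_lt a t0 hat0)))
      as (t1 & I1 & _ & t01).
    apply (sup_on_best_Ulam_constant I A B G alpha beta _ F L t1 t0); auto.
    intros t It. unfold kappa32. fold F.
    rewrite (is_RInt_gen_unique (kappa32_integrand alpha t) (exp (A t) * (G t - L))).
    + f_equal. rewrite Rabs_pos_eq; auto.
      apply Rge_le, Rge_minus, Rle_ge.
      (* Now [s] lies to the left of [t], so [L <= G t], the opposite sign to the right end. *)
      apply (filterlim_le (F := F) G (fun _ => G t) L (G t)); auto.
      * generalize (filter_and _ _ FI (Rbar_at_right_lt a t (ta t It))).
        apply filter_imp. intros s (Is & _ & ts).
        apply (exp_antiderivative_increasing I A G s t); auto. lra.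
      * apply filterlim_const.
    + apply (kappa32_kappa31 I); auto. apply PF.
      replace (- (exp (A t) * (G t - L))) with (exp (A t) * (L - G t)) by ring.
      now apply Hk.
Qed.
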